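(* Let $P_n$ be the path graph with $n\geq 3$ vertices $v_1,\ldots,v_n$ (in path order), and let $\mathcal{H}=(H^1,H^2,\ldots,H^n)$ be a sequence of graphs each of which is a path graph or a cycle graph, with $|V(H^i)|>6$ for every $i$. Then $$\dim_{\mathrm{diam}}(P_n\odot\mathcal{H})=|D(P_n\odot\mathcal{H})|+\sum_{i=2}^{n-1}\dim(K_1+H^i).$$
   Context: Distances are shortest-path distances: $d_G(u,v)$ is the length of a shortest $u$–$v$ path in the connected graph $G$. The eccentricity of $v$ is $e_G(v)=\max_{u\in V(G)}d_G(u,v)$ and $\operatorname{diam}(G)=\max_v e_G(v)$. A vertex is diametral if its eccentricity equals $\operatorname{diam}(G)$; the diametral set $D(G)$ is the set of all diametral vertices of $G$. For an ordered set $W=\{w_1,\ldots,w_k\}\subseteq V(G)$, the representation of $v$ is $r(v\mid W)=(d_G(v,w_1),\ldots,d_G(v,w_k))$. $W$ is a resolving set of $G$ if $r(u\mid W)\neq r(v\mid W)$ for all distinct $u,v\in V(G)$. The metric dimension $\dim(G)$ is the minimum cardinality of a resolving set of $G$. A diametral resolving set is a resolving set $W$ with $D(G)\subseteq W$; the diametral metric dimension $\dim_{\mathrm{diam}}(G)$ is the minimum cardinality of a diametral resolving set of $G$. Generalized corona: for a graph $G$ with $V(G)=\{v_1,\ldots,v_n\}$ and a sequence of graphs $\mathcal{H}=(H^1,\ldots,H^n)$, $G\odot\mathcal{H}$ is the graph obtained by taking one copy of $G$ and one (disjoint) copy of each $H^i$, and joining the vertex $v_i$ of $G$ to every vertex of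 the copy of $H^i$, for each $i=1,\ldots,n$. $K_1+H$ denotes the join of a single vertex with $H$, i.e. $H$ together with one new vertex adjacent to every vertex of $H$. *)

(* Defs.v *)
From mathcomp Require Import all_boot.

Set Implicit Arguments.
Unset Strict Implicit.
Unset Printing Implicit Defensive.

(* Finite simple graphs *)
Record sgraph := SGraph {
  vert :> finType;
  adj : rel vert;
  adj_sym : symmetric adj;
  adj_irr : irreflexive adj }.

Definition isomorphic (G H : sgraph) : Prop :=
  exists2 f : G -> H, bijective f & forall x y, adj (f x) (f y) = adj x y.

Section PathCycle.
Variable n : nat.

Definition path_adj : rel 'I_n := fun i j => (i.+1 == j :> nat) || (j.+1 == i :> nat).

Lemma path_adj_sym : symmetric path_adj.
Proof. by move=> i j; rewrite /path_adj orbC. Qed.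

Lemma path_adj_irr : irreflexive path_adj.
Proof. by move=> i; rewrite /path_adj orbb gtn_eqF. Qed.

Definition path_graph := SGraph path_adj_sym path_adj_irr.

(* ordS is the successor modulo n; the test i != j only matters for n = 1,
   which is_cycle_graph excludes. *)
Definition cycle_adj : rel 'I_n :=
  fun i j => (i != j) && ((ordS i == j) || (ordS j == i)).

Lemma cycle_adj_sym : symmetric cycle_adj.
Proof. by move=> i j; rewrite /cycle_adj eq_sym orbC. Qed.

Lemma cycle_adj_irr : irreflexive cycle_adj.
Proof. by move=> i; rewrite /cycle_adj eqxx. Qed.

Definition cycle_graph := SGraph cycle_adj_sym cycle_adj_irr.

End PathCycle.

Definition is_path_graph (H : sgraph) : Prop :=
  exists n, isomorphic H (path_graph n).

Definition is_cycle_graph (H : sgraph) : Prop :=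
  exists2 n, 3 <= n & isomorphic H (cycle_graph n).

Section Corona.
Variables (G : sgraph) (H : G -> sgraph).

(* inr (Tagged _ x) with x : H v is the vertex x of the copy of H v attached
   to v. *)
Definition corona_adj : rel (G + {v : G & H v}) := fun a b =>
  match a, b with
  | inl u, inl v => adj u v
  | inl u, inr y => u == tag y
  | inr x, inl v => tag x == v
  | inr x, inr y => (tag x == tag y) && adj (tagged x) (tagged_as x y)
  end.

Lemma corona_adj_sym : symmetric corona_adj.
Proof.
case=> [u|[u x]] [v|[v y]] //=; [exact: adj_sym | exact: eq_sym..|].
rewrite eq_sym; case: eqP => //= Euv; case: _ / Euv in x *.
by rewrite !tagged_asE /= adj_sym.
Qed.

Lemma corona_adj_irr : irreflexive corona_adj.
Proof.
case=> [u|[u x]] /=; first exact: adj_irr.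
by rewrite eqxx tagged_asE /= adj_irr.
Qed.

Definition corona := SGraph corona_adj_sym corona_adj_irr.

End Corona.

Section JoinK1.
Variable H : sgraph.

(* The join K_1 + H; None is the vertex of K_1. *)
Definition joinK1_adj : rel (option H) := fun a b =>
  match a, b with
  | Some x, Some y => adj x y
  | None, None => false
  | _, _ => true
  end.

Lemma joinK1_adj_sym : symmetric joinK1_adj.
Proof. by case=> [x|] [y|] //=; apply: adj_sym. Qed.

Lemma joinK1_adj_irr : irreflexive joinK1_adj.
Proof. by case=> [x|] //=; apply: adj_irr. Qed.

Definition joinK1 := SGraph joinK1_adj_sym joinK1_adj_irr.

End JoinK1.

Section Metric.
Variable G : sgraph.
Implicit Types (u v w : G) (W : {set G}).

Definition is_path u v (p : seq G) : bool :=
  [&& path (@adj G) u p, last u p == v & uniq (u :: p)].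

(* A path has fewer than #|G| edges, so the range k < #|G| is exhaustive; the
   value is #|G| when u and v are not connected. *)
Definition dist u v : nat :=
  \big[minn/#|G|]_(k < #|G| | [exists p : k.-tuple G, is_path u v p]) k.

Definition ecc v : nat := \max_(u : G) dist u v.

Definition diam : nat := \max_(v : G) ecc v.

Definition diametral_set : {set G} := [set v | ecc v == diam].

(* The ordering of W is the one of enum W. *)
Definition representation W v : seq nat := [seq dist v w | w <- enum W].

Definition resolving W : bool :=
  [forall u, forall v, (u != v) ==> (representation W u != representation W v)].

Definition diametral_resolving W : bool :=
  resolving W && (diametral_set \subset W).

Lemma dist_le u v k (p : k.-tuple G) : is_path u v p -> dist u v <= k.
Proof.
move=> Pp; have ltk : k < #|G|.
  case/and3P: (Pp) => _ _ Up.
  by rewrite -{1}(size_tuple p) -[_.+1]/(size (u :: p)) -(card_uniqP Up) max_card.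
have Pk : [exists q : (Ordinal ltk).-tuple G, is_path u v q].
  by apply/existsP; exists p.
rewrite /dist -[k in _ <= k]/(val (Ordinal ltk)).
have := mem_index_enum (Ordinal ltk); elim: index_enum => //= i r IH.
rewrite inE big_cons => /predU1P[<-|/IH le_r]; first by rewrite Pk geq_minl.
by case: ifP => // _; rewrite geq_min le_r orbT.
Qed.

Lemma dist_eq0 u v : (dist u v == 0) = (u == v).
Proof.
apply/eqP/eqP => [|->]; last first.
  apply/eqP; rewrite -leqn0 (@dist_le v v 0 [tuple]) //.
  by rewrite /is_path /= eqxx.
have cardG : 0 < #|G| by apply/card_gt0P; exists u.
rewrite /dist; elim/big_rec: _ => [G0|k m /existsP[p /and3P[_ /eqP lp _]] IH].
  by rewrite G0 in cardG.
rewrite /minn; case: ltnP => // _ k0.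
have /size0nil p0 : size p = 0 by rewrite size_tuple.
by rewrite -lp p0.
Qed.

Lemma resolvingT : resolving [set: G].
Proof.
apply/forallP=> u; apply/forallP=> v; apply/implyP; apply: contraNN => /eqP.
move/eq_in_map/(_ v); rewrite mem_enum inE => /(_ isT) duv.
by rewrite -dist_eq0 duv dist_eq0.
Qed.

Lemma diametral_resolvingT : diametral_resolving [set: G].
Proof. by rewrite /diametral_resolving resolvingT subsetT. Qed.

(* By the two lemmas above, the whole vertex set is an admissible starting
   point, so these are minima for every G. *)
Definition metric_dim : nat :=
  #|[arg min_(W < [set: G] | resolving W) #|W| ]|.

Definition diametral_metric_dim : nat :=
  #|[arg min_(W < [set: G] | diametral_resolving W) #|W| ]|.

End Metric.

(* Main.v *)
Require Import Defs.
From mathcomp Require Import all_boot.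
From mathcomp Require Import zify.

(** Every vertex of a copy [H^i] sees the outside of that copy only through
    [v_i].  Hence two vertices of a middle copy can only be separated from
    inside that copy, whereas any other pair is separated by the end copies,
    whose union is exactly the diametral set.  It remains to see that separating
    the vertices of [H^i] costs as much as resolving [K_1 + H^i]: a separating
    set of [k] vertices leaves at most [2 ^ k] other vertices, so [6 < #|H^i|]
    forces [2 < k], and as degrees are at most 2 no vertex of [H^i] is then
    confused with the apex, which is at distance 1 from all of [H^i]. *)

Set Implicit Arguments.
Unset Strict Implicit.
Unset Printing Implicit Defensive.

(** * Certifying distances by a potential; characterisations of resolving sets *)

Section Metric.
Variable G : sgraph.
Implicit Types (u v w : G) (W : {set G}).

(** Since [f] drops by at most 1 along an edge, [f u] bounds the length of every path to [v] from
    below, and greedy descent yields a path of exactly that length. Distances below are thus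
    obtained by checking a guessed formula. *)
Lemma dist_potential v (f : G -> nat) :
    f v = 0 ->
    (forall a b, adj a b -> f a <= (f b).+1) ->
    (forall a, a != v -> exists2 b, adj a b & f a = (f b).+1) ->
  forall u, dist u v = f u.
Proof.
move=> fv f_lip f_desc u.
have lb (p : seq G) : forall a, path (@adj G) a p -> last a p = v -> f a <= size p.
  elim: p => [|b p IH] a /=; first by move=> _ ->; rewrite fv.
  by case/andP=> /f_lip le_ab pp lp; apply: leq_trans le_ab _; apply: IH.
(* The last conjunct strengthens the induction: as [f] decreases strictly, the descent never repeats
   a vertex. *)
have [p [Pp szp _]] :
    exists p, [/\ is_path u v p, size p = f u & all (fun x => f x < f u) p].
  move Ek: (f u) => k; elim: k u Ek => [|k IH] a fa.
    exists [::]; split=> //; rewrite /is_path /= andbT.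
    by have [//|/f_desc[b _]] := eqVneq a v; rewrite fa.
  have /f_desc[b ab fab] : a != v by apply/eqP => av; rewrite av fv in fa.
  have fb : f b = k by lia.
  have [p [/and3P[pp lp up] szp lt_p]] := IH b fb.
  have lt_bp : all (fun x => f x < k.+1) (b :: p).
    by rewrite /= fb leqnn; apply: sub_all lt_p => x /leqW.
  exists (b :: p); split=> //=; last by rewrite szp.
  rewrite /is_path /= ab pp lp /= -/(uniq (b :: p)) up andbT.
  by apply/negP => /(allP lt_bp); rewrite fa ltnn.
apply/eqP; rewrite eqn_leq -szp; apply/andP; split.
  exact: (@dist_le _ _ _ _ (in_tuple p)).
rewrite szp /dist; apply: (big_ind (fun m => f u <= m)).
(* The default value [#|G|] is large enough, because [u :: p] has no repetition. *)
- case/and3P: Pp => _ _ /card_uniqP /= card_up.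
  by rewrite -szp ltnW // -card_up max_card.
- by move=> x y; rewrite leq_min => -> ->.
- move=> k /existsP[q /and3P[pq /eqP lq _]].
  by rewrite -(size_tuple q); apply: lb.
Qed.

Lemma resolvingP W :
  reflect (forall u v, (forall w, w \in W -> dist u w = dist v w) -> u = v)
          (resolving W).
Proof.
apply: (iffP forallP) => [resW u v duv|resW u].
  have /forallP/(_ v) := resW u; apply: contraTeq => uv.
  rewrite uv negbK; apply/eqP/eq_in_map => w; rewrite mem_enum.
  exact: duv.
apply/forallP=> v; apply/implyP; apply: contraNneq => /eq_in_map duv.
by apply/eqP/resW => w wW; apply: duv; rewrite mem_enum.
Qed.

Lemma metric_dim_le W : resolving W -> metric_dim G <= #|W|.
Proof.
by rewrite /metric_dim; case: arg_minnP => [|S _]; [apply: resolvingT | apply].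
Qed.

Lemma metric_dim_ex : exists2 W : {set G}, resolving W & #|W| = metric_dim G.
Proof.
rewrite /metric_dim; case: arg_minnP => [|S resS _]; first exact: resolvingT.
by exists S.
Qed.

Lemma diametral_metric_dim_le W :
  diametral_resolving W -> diametral_metric_dim G <= #|W|.
Proof.
rewrite /diametral_metric_dim; case: arg_minnP => [|S _]; last exact.
exact: diametral_resolvingT.
Qed.

Lemma diametral_metric_dim_ex :
  exists2 W : {set G}, diametral_resolving W & #|W| = diametral_metric_dim G.
Proof.
rewrite /diametral_metric_dim; case: arg_minnP => [|S resS _].
  exact: diametral_resolvingT.
by exists S.
Qed.

End Metric.

(** * Degrees in paths and cycles *)

Lemma cycle_nbhd n (i j : 'I_n) :
  (ordS i == j) || (ordS j == i) -> j \in [set ordS i; ord_pred i].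
Proof.
rewrite !inE => /orP[/eqP->|/eqP<-]; first by rewrite eqxx.
by rewrite ordSK eqxx orbT.
Qed.

(** No wrap-around occurs along a path, so one neighbourhood bound serves both families. *)
Lemma path_adj_ordS n (i j : 'I_n) :
  path_adj i j -> (ordS i == j) || (ordS j == i).
Proof.
by case/orP=> /eqP e; apply/orP; [left|right]; apply/eqP/val_inj;
  rewrite /= e modn_small.
Qed.

Lemma isomorphic_degree_le (G K : sgraph) d :
    isomorphic G K -> (forall y : K, #|[set z | adj y z]| <= d) ->
  forall x : G, #|[set z | adj x z]| <= d.
Proof.
case=> f /bij_inj f_inj f_adj degK x; apply: leq_trans (degK (f x)).
rewrite -(card_imset _ f_inj); apply/subset_leq_card/subsetP.
by move=> _ /imsetP[z xz ->]; rewrite !inE f_adj in xz *.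
Qed.

Lemma path_or_cycle_degree_le2 (G : sgraph) :
    is_path_graph G \/ is_cycle_graph G ->
  forall x : G, #|[set z | adj x z]| <= 2.
Proof.
have le2 n (i : 'I_n) (A : {set 'I_n}) :
    {in A, forall j, (ordS i == j) || (ordS j == i)} -> #|A| <= 2.
  move=> A_nbhd; apply: leq_trans (_ : #|[set ordS i; ord_pred i]| <= 2).
    by apply/subset_leq_card/subsetP => j /A_nbhd; apply: cycle_nbhd.
  by rewrite cards2; case: (_ != _).
case=> [[n]|[n _]] /isomorphic_degree_le; apply=> i; apply: (le2 _ i) => j.
  by rewrite inE => /path_adj_ordS.
by rewrite inE => /andP[].
Qed.

(** * Separating sets of $H$ and the metric dimension of $K_1+H$ *)

Section Join.
Variable H : sgraph.
Implicit Types (x y : H) (S : {set H}).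

Lemma joinK1_dist (a b : joinK1 H) :
  dist a b = if a == b then 0 else if adj a b then 1 else 2.
Proof.
pose f (c : joinK1 H) := if c == b then 0 else if adj c b then 1 else 2.
apply: (@dist_potential _ b f); rewrite /f.
- by rewrite eqxx.
- move=> c c' cc'; case: (eqVneq c' b) => [<-|_]; first by rewrite cc'; case: eqP.
  by case: (c == b); case: (adj c b); case: (adj c' b).
- move=> {f} c cb; rewrite (negPf cb); case: ifPn => [adjcb|nadj].
    by exists b; rewrite ?eqxx.
  (* Distinct non-adjacent vertices both lie in [H], and the apex is a common neighbour. *)
  exists None; first by case: c cb nadj => //; case: b.
  by case: b c cb nadj => [y|] [x|].
Qed.

(** Distances are taken in $K_1+H$ because they are those between vertices of one copy in the
    corona; the apex itself need not be told apart. *)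
Definition separating S :=
  forall x y, (forall w, w \in S ->
    dist (Some x : joinK1 H) (Some w) = dist (Some y : joinK1 H) (Some w)) ->
  x = y.

(** Outside [S] distances to [S] are 1 or 2, so a vertex is determined by its set of neighbours in
    [S]. *)
Lemma separating_card S : separating S -> #|H| <= #|S| + 2 ^ #|S|.
Proof.
move=> sepS; rewrite -(cardsC S) leq_add2l -card_powerset.
pose trace x := [set w in S | adj x w].
have trace_inj : {in ~: S &, injective trace}.
  move=> x y; rewrite !inE => xS yS /setP trxy; apply: sepS => w wS.
  have := trxy w; rewrite !inE wS /= !joinK1_dist /= => ->.
  have neq z : z \notin S -> (Some z == Some w) = false.
    by move=> zS; apply/eqP => -[zw]; rewrite zw wS in zS.
  by rewrite !neq.
rewrite -(card_in_imset trace_inj); apply/subset_leq_card/subsetP.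
move=> _ /imsetP[x _ ->]; rewrite inE; apply/subsetP => w.
by rewrite inE => /andP[].
Qed.

Lemma resolving_separating (W : {set joinK1 H}) :
  resolving W -> separating [set x | Some x \in W].
Proof.
move/resolvingP=> resW x y dxy; apply: Some_inj; apply: resW => -[w|] wW.
  by apply: dxy; rewrite inE.
by rewrite !joinK1_dist.
Qed.

Lemma separating_resolving S :
    (forall x, #|[set y | adj x y]| <= 2) -> 6 < #|H| -> separating S ->
  resolving ([set Some x | x in S] : {set joinK1 H}).
Proof.
move=> deg2 cardH sepS.
have S3 : 2 < #|S|.
  rewrite ltnNge; apply/negP => S2; move: cardH; apply/negP; rewrite -leqNgt.
  apply: leq_trans (separating_card sepS) _.
  by rewrite -[6]/(2 + 2 ^ 2) leq_add // leq_exp2l.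
(* Otherwise all of [S], at least three vertices, would be adjacent to [x]. *)
have apex x : ~ forall w, w \in S -> dist (Some x : joinK1 H) (Some w) = 1.
  move=> dx; have := leq_trans S3 (leq_trans _ (deg2 x)); rewrite ltnn => K.
  apply: notF; apply: K; apply/subset_leq_card/subsetP => w /dx.
  by rewrite joinK1_dist inE /=; case: (_ == _) => //; case: (adj x w).
have dN w : dist (None : joinK1 H) (Some w) = 1 by rewrite joinK1_dist.
apply/resolvingP => -[x|] [y|] // duv.
- by congr Some; apply: sepS => w wS; apply: duv; apply: imset_f.
- by case: (apex x) => w wS; rewrite -(dN w); apply: duv; apply: imset_f.
- by case: (apex y) => w wS; rewrite -(dN w); apply/esym/duv/imset_f.
Qed.

Lemma metric_dim_joinK1_le S :
    (forall x, #|[set y | adj x y]| <= 2) -> 6 < #|H| -> separating S ->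
  metric_dim (joinK1 H) <= #|S|.
Proof.
move=> deg2 cardH /(separating_resolving deg2 cardH)/metric_dim_le.
by rewrite card_imset //; apply: Some_inj.
Qed.

Lemma metric_dim_joinK1_ex :
  exists2 S, separating S & #|S| <= metric_dim (joinK1 H).
Proof.
have [W resW <-] := metric_dim_ex (joinK1 H).
exists [set x | Some x \in W]; first exact: resolving_separating.
rewrite -(card_imset _ (@Some_inj _)); apply/subset_leq_card/subsetP.
by move=> _ /imsetP[x xW ->]; rewrite inE in xW.
Qed.

End Join.

Lemma card_tagged_set (I : finType) (T : I -> finType) (P : pred I)
    (S : forall i, {set T i}) :
  #|[set p : {i : I & T i} | P (tag p) && (tagged p \in S (tag p))]|
    = \sum_(i | P i) #|S i|.
Proof.
rewrite -sum1dep_card -(sig_big_dep P (fun i x => x \in S i) (fun _ _ => 1)).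
by apply: eq_bigr => i _; rewrite sum1_card.
Qed.

(** * Distances in the corona of a path *)

Section PathCorona.
Variables (n : nat) (H : 'I_n -> sgraph).
Local Notation C := (@corona (path_graph n) H).
Implicit Types (a b c : C) (p q : {i : path_graph n & H i}).

Definition base a : 'I_n := match a with inl i => i | inr p => tag p end.
Definition height a : nat := if a is inr _ then 1 else 0.
(** With truncated subtraction this is $|i-j|$. *)
Definition gap (i j : nat) := (i - j) + (j - i).
(** Length of the walk that goes down to the path, along it, and up again. *)
Definition route a b := gap (base a) (base b) + height a + height b.

(* A shortest path follows [route] unless it stays within one copy. *)
Definition cdist b a := if a == b then 0 else if adj a b then 1 else route a b.

Lemma height_le1 a : height a <= 1.
Proof. by case: a. Qed.

Lemma adj_corona a b : adj a b ->
     height a + height b = 0 /\ gap (base a) (base b) = 1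
  \/ base a = base b :> nat /\ 0 < height a + height b.
Proof.
case: a b => [i|p] [j|q] /=; rewrite /gap.
- by move=> /= /orP[]/eqP e; left; lia.
- by move/eqP=> ->; right.
- by move/eqP=> ->; right.
- by case/andP=> /eqP e _; right; rewrite e.
Qed.

Lemma cdist_le_route a b : cdist b a <= route a b.
Proof.
rewrite /cdist /route; case: eqP => // _; case: ifP => // /adj_corona.
by case=> [[]|[_]]; lia.
Qed.

Lemma cdist_height0 a b : height a = 0 -> cdist b a = route a b.
Proof.
rewrite /cdist /route => ha; case: eqP => [<-|_]; first by rewrite /gap; lia.
have := height_le1 b; case: ifP => // /adj_corona hab hb.
by case: hab; rewrite /gap => -[]; lia.
Qed.

Lemma cdist_lip a b c : adj a c -> cdist b a <= (cdist b c).+1.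
Proof.
move=> ac; have [->|cb] := eqVneq b a; first by rewrite /cdist eqxx.
have [->|bc] := eqVneq b c; first by rewrite /cdist ac; case: eqP.
apply: leq_trans (cdist_le_route a b) _.
rewrite /cdist eq_sym (negPf bc) /route.
have := height_le1 a; have := height_le1 b; have := height_le1 c.
rewrite /gap; case: ifP => [/adj_corona|_]; move: (adj_corona ac); rewrite /gap.
  lia.
lia.
Qed.

Lemma cdist_desc a b : a != b -> exists2 c, adj a c & cdist b a = (cdist b c).+1.
Proof.
move=> ab; rewrite {1}/cdist (negPf ab).
case: ifPn => [adjab|nab]; first by exists b; rewrite // /cdist eqxx.
case: a ab nab => [i|p] ab nab; last first.
  (* From a copy, go down to the path; from a path vertex, move along the path towards [base b]. *)
  exists (inl (tag p)); first exact: eqxx.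
  by rewrite cdist_height0 // /route /=; lia.
have ib : (i : nat) != base b.
  case: b ab nab => [j|q] //=.
have [lt_ib|le_bi] := ltnP i (base b).
  have lt_n : i.+1 < n by apply: leq_ltn_trans lt_ib (ltn_ord _).
  exists (inl (Ordinal lt_n)); first by rewrite /= /path_adj /= eqxx.
  by rewrite cdist_height0 // /route /gap /=; lia.
have lt_n : i.-1 < n by apply: leq_ltn_trans (leq_pred _) (ltn_ord i).
exists (inl (Ordinal lt_n)); first by rewrite /= /path_adj /=; lia.
by rewrite cdist_height0 // /route /gap /=; lia.
Qed.

Lemma corona_dist a b : dist a b = cdist b a.
Proof.
apply: (@dist_potential C b (cdist b)); first by rewrite /cdist eqxx.
  by move=> ? ?; apply: cdist_lip.
by move=> ? ?; apply: cdist_desc.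
Qed.

(** The base vertex acts as the apex: a route within one copy has length 2. *)
Lemma corona_dist_copy i (x y : H i) :
  dist (inr (Tagged H x) : C) (inr (Tagged H y))
    = dist (Some x : joinK1 (H i)) (Some y).
Proof.
rewrite corona_dist joinK1_dist /cdist /route /gap /= subnn.
by rewrite !eqxx tagged_asE /= (inj_eq (@inr_inj _ _)) eq_Tagged.
Qed.

Lemma corona_dist_far a b :
  height a = 0 \/ base a <> base b -> dist a b = route a b.
Proof.
rewrite corona_dist; case=> [|nab]; first exact: cdist_height0.
rewrite /cdist; case: eqP => [ab|_]; first by rewrite ab in nab.
case: ifP => // /adj_corona[[hab gap_ab]|[/val_inj]//].
by rewrite /route -addnA hab gap_ab.
Qed.

Lemma resolving_copy_separating (W : {set C}) i :
  resolving W -> separating [set x : H i | inr (Tagged H x) \in W].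
Proof.
move/resolvingP=> resW x y dxy.
suff /eqP : inr (Tagged H x) = inr (Tagged H y) :> C.
  by rewrite (inj_eq (@inr_inj _ _)) eq_Tagged => /eqP.
apply: resW => w wW.
case: w wW => [j|[j w]] wW.
  (* Landmarks outside the copy see only the base and the height, which [x] and [y] share. *)
  by rewrite !corona_dist /cdist /= /route.
have [ij|/eqP ij] := eqVneq i j; last by rewrite !corona_dist_far //; right.
case: _ / ij in w wW *.
by rewrite !corona_dist_copy; apply: dxy; rewrite inE.
Qed.

(** Indices start at 0, so these are the vertices $v_2,\ldots,v_{n-1}$. *)
Definition middle (i : 'I_n) := 0 < i < n.-1.

(** * Eccentricities and the diametral set *)

Hypothesis n_ge3 : 3 <= n.
Hypothesis H_gt0 : forall i, 0 < #|H i|.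

(** A route of length $n+1$ needs a gap of $n-1$ and both endpoints in copies. *)
Lemma ecc_corona_le b : ecc b <= n + ((0 < height b) && ~~ middle (base b)).
Proof.
apply/bigmax_leqP => a _; rewrite corona_dist.
apply: leq_trans (cdist_le_route a b) _.
have := height_le1 a; have := height_le1 b.
have := ltn_ord (base a); have := ltn_ord (base b).
by rewrite /route /gap /middle; lia.
Qed.

Lemma dist_end_copies (i j : 'I_n) (x : H i) (y : H j) :
  gap i j = n.-1 -> dist (inr (Tagged H x) : C) (inr (Tagged H y)) = n.+1.
Proof.
move=> ij; rewrite corona_dist_far; first by rewrite /route /= ij; lia.
by right=> /= e; move: ij; rewrite e /gap; lia.
Qed.

Lemma ord_first : exists i : 'I_n, i = 0 :> nat.
Proof. by have lt0 : 0 < n; [lia | exists (Ordinal lt0)]. Qed.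

Lemma ord_last : exists i : 'I_n, i = n.-1 :> nat.
Proof. by have ltn1 : n.-1 < n; [lia | exists (Ordinal ltn1)]. Qed.

Lemma ecc_end_copy p : ~~ middle (tag p) -> ecc (inr p : C) = n.+1.
Proof.
move=> p_end; apply/eqP; rewrite eqn_leq; apply/andP; split.
  by apply: leq_trans (ecc_corona_le _) _; rewrite p_end /= addn1.
case: p p_end => i x /= i_end.
have le_ecc a : dist a (inr (Tagged H x) : C) <= ecc (inr (Tagged H x) : C).
  exact: (leq_bigmax (F := fun u => dist u _)).
(* The bound is attained at any vertex of the copy at the opposite end. *)
have [i0|i_gt0] := posnP i.
  have [j jn] := ord_last; have /card_gt0P[y _] := H_gt0 j.
  apply: leq_trans (le_ecc (inr (Tagged H y))).
  by rewrite dist_end_copies // /gap; lia.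
have [j j0] := ord_first; have /card_gt0P[y _] := H_gt0 j.
apply: leq_trans (le_ecc (inr (Tagged H y))).
have i_last : i = n.-1 :> nat by have := ltn_ord i; rewrite /middle in i_end; lia.
by rewrite dist_end_copies // /gap; lia.
Qed.

Lemma diametral_set_corona :
  diametral_set C = [set inr p | p in [set p | ~~ middle (tag p)]].
Proof.
have diamC : diam C = n.+1.
  apply/eqP; rewrite eqn_leq; apply/andP; split.
    apply/bigmax_leqP => a _; apply: leq_trans (ecc_corona_le a) _.
    by rewrite -[n.+1]addn1 leq_add2l leq_b1.
  have [i i0] := ord_first; have /card_gt0P[x _] := H_gt0 i.
  rewrite -(@ecc_end_copy (Tagged H x)) ?leq_bigmax //.
  by rewrite /middle /= i0.
apply/setP => a; rewrite inE diamC; apply/idP/imsetP => [/eqP ecc_a|[p]].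
  have := ecc_corona_le a; rewrite ecc_a -[n.+1]addn1 leq_add2l lt0b => /andP[].
  by case: a {ecc_a} => //= p _ p_end; exists p; rewrite ?inE.
by rewrite inE => p_end ->; rewrite ecc_end_copy.
Qed.

(** * Diametral resolving sets: the end copies plus landmarks in the middle copies *)

Definition ends_with (S : forall i, {set H i}) : {set C} :=
  [set inr p | p in
    [set p | ~~ middle (tag p)] :|:
    [set p | middle (tag p) && (tagged p \in S (tag p))]].

Lemma separating_resolving_corona (S : forall i, {set H i}) :
  (forall i, separating (S i)) -> resolving (ends_with S).
Proof.
move=> sepS; apply/resolvingP => a b dab.
have d_end p : ~~ middle (tag p) -> dist a (inr p : C) = dist b (inr p : C).
  by move=> p_end; apply: dab; apply: imset_f; rewrite !inE p_end.
have end_copy c : {p | ~~ middle (tag p) & c = inr p}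
    + {height c = 0 \/ middle (base c)}.
  case: c => [i|p]; first by right; left.
  by case: (boolP (middle (tag p))) => Mp; [right; right | left; exists p].
(* A vertex of an end copy is itself a landmark, the only vertex at distance 0 from it. *)
have [[p p_end ap]|a_mid] := end_copy a.
  have := d_end p p_end; rewrite -ap => /esym/eqP.
  by rewrite (eqP (_ : dist a a == 0)) ?dist_eq0 // => /eqP.
have [[p p_end bp]|b_mid] := end_copy b.
  have := d_end p p_end; rewrite -bp => /eqP.
  by rewrite (eqP (_ : dist b b == 0)) ?dist_eq0 // => /eqP.
have d_route c p : height c = 0 \/ middle (base c) -> ~~ middle (tag p) ->
    dist c (inr p : C) = route c (inr p).
  move=> c_mid p_end; rewrite corona_dist_far //.
  by case: c_mid => [|c_mid]; [left | right=> e; rewrite e /= (negPf p_end) in c_mid].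
(* Landmarks in the first and last copies are at distances base + height + 1 and $(n-1)$ - base +
   height + 1: the sum gives the height, the difference the base. *)
have [i0 i0E] := ord_first; have /card_gt0P[x0 _] := H_gt0 i0.
have [i1 i1E] := ord_last; have /card_gt0P[x1 _] := H_gt0 i1.
have := d_end (Tagged H x0); have := d_end (Tagged H x1).
rewrite !d_route //=; try by rewrite /middle ?i0E ?i1E ?ltnn ?andbF.
rewrite /middle i0E i1E ltnn andbF => /(_ isT) d1 /(_ isT) d0.
have := ltn_ord (base a); have := ltn_ord (base b).
move: d1 d0; rewrite /route /gap /= i0E i1E => d1 d0 lt_b lt_a.
have base_ab : base a = base b by apply: val_inj => /=; lia.
have height_ab : height a = height b by lia.
case: a b base_ab height_ab a_mid {b_mid d0 d1 lt_a lt_b d_end} dab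
  => [i|[i x]] [j|[j y]] //= ij _; first by rewrite ij.
(* Only pairs within one middle copy remain, and [S i] separates these. *)
case: _ / ij in y *.
case=> // i_mid dab; congr (inr (existT _ i _)); apply: sepS => w wS.
have := dab (inr (Tagged H w)); rewrite !corona_dist_copy; apply.
by apply: imset_f; rewrite !inE /= i_mid wS orbT.
Qed.

Lemma card_ends_with (S : forall i, {set H i}) :
  #|ends_with S| = #|diametral_set C| + \sum_(i < n | middle i) #|S i|.
Proof.
rewrite diametral_set_corona !(card_imset _ (@inr_inj _ _)).
rewrite -(card_tagged_set middle S) cardsU.
rewrite (_ : _ :&: _ = set0) ?cards0 ?subn0 //.
by apply/setP => p; rewrite !inE; case: middle.
Qed.

End PathCorona.

Theorem theorem3p2 (n : nat) (hn : 3 <= n) (H : 'I_n -> sgraph)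
    (hH : forall i : 'I_n, is_path_graph (H i) \/ is_cycle_graph (H i))
    (hcard : forall i : 'I_n, 6 < #|H i|) :
  diametral_metric_dim (@corona (path_graph n) H) =
    #|diametral_set (@corona (path_graph n) H)|
    + \sum_(i < n | 0 < i < n.-1) metric_dim (joinK1 (H i)).
Proof.
have H_gt0 i : 0 < #|H i| by apply: leq_trans (hcard i).
apply/eqP; rewrite eqn_leq; apply/andP; split.
  (* Upper bound: small separating sets in the middle copies, completed by the end copies. *)
  have [S sepS le_S] := fin_all_exists2 (fun i => metric_dim_joinK1_ex (H i)).
  apply: leq_trans (diametral_metric_dim_le (_ : diametral_resolving (ends_with S))) _.
    rewrite /diametral_resolving separating_resolving_corona //.
    by rewrite diametral_set_corona // imsetS // subsetUl.
  by rewrite card_ends_with // leq_add2l leq_sum.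
(* Lower bound: a minimum [W] contains the end copies and meets each middle copy in a separating
   set, so it contains [ends_with S] for these traces [S]. *)
have [W /andP[resW subW] <-] := diametral_metric_dim_ex (@corona (path_graph n) H).
pose S i := [set x : H i | inr (Tagged H x) \in W].
apply: (@leq_trans (#|diametral_set (@corona (path_graph n) H)|
    + \sum_(i < n | middle i) #|S i|)).
  rewrite leq_add2l leq_sum // => i _.
  apply: metric_dim_joinK1_le => //; first exact: path_or_cycle_degree_le2.
  exact: resolving_copy_separating.
rewrite -card_ends_with //; apply/subset_leq_card/subsetP.
move=> _ /imsetP[p + ->]; rewrite inE => /orP[p_end|]; last first.
  by case: p => i x; rewrite !inE /= => /andP[].
by apply: (subsetP subW); rewrite diametral_set_corona // imset_f.
Qed.
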